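(* Consider the problem $\min_{x\in\mathcal X}\varphi(x)$ with $\varphi(x)=F(f(x),x)$ and the Hybrid Momentum Stochastic Frank--Wolfe algorithm (Variant I or Variant II), as described in the context, where $\mathcal X\subset\mathbb R^d$ is convex and compact with diameter $D_{\mathcal X}<\infty$; $F:\mathbb R^n\times\mathcal X\to\mathbb R$ is $L_F$-Lipschitz in its first argument $u$, monotone non-decreasing in $u$ ($u_1\le u_2$ componentwise implies $F(u_1,x)\le F(u_2,x)$) and subhomogeneous in $u$ ($F(\gamma u,x)\le\gamma F(u,x)$ for all $\gamma\ge1$); and $f:\mathcal X\to\mathbb R^n$ has $L$-Lipschitz Jacobian, $\|\nabla f(x)-\nabla f(y)\|_{\mathrm{op}}\le L\|x-y\|$ for all $x,y\in\mathcal X$. Suppose the stochastic oracle is exact, i.e. for every $x\in\mathcal X$, $\tilde f(x;\xi)=f(x)$ and $\nabla\tilde f(x;\xi)=\nabla f(x)$ almost surely. Set $\beta_k=\rho_k=1$ for all $k$. Then the trackers are exact: $V_k=\nabla f(y_k)$ and $z_k=f(y_k)$ for all $k\ge1$, and the algorithm reduces to the deterministic Basic Method $$x_{k+1}\in\arg\min_{x\in\mathcal X}F\big(f(y_k)+\nabla f(y_k)(x-y_k),x\big),\qquad y_{k+1}=(1-\gamma_k)y_k+\gamma_kx_{k+1}.$$ Moreover, with $x^*\in\arg\min_{x\in\mathcal X}\varphi(x)$ and $\Phi_0=\varphi(y_0)-\varphi(x^* )$, the iterates satisfy: (a) Convex case: if in addition each component $f_i$ is convex on $\mathcal X$ and $F(u,x)$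 is jointly convex in $(u,x)$, and $\gamma_k=2/(k+2)$, then for every $K\ge1$, $\ \varphi(y_K)-\varphi(x^* )\le\dfrac{2\mathcal S}{K+1}$. (b) Non-convex case: if $\gamma_k=1/\sqrt{k+1}$, then for every $K\ge1$, $$\min_{0\le k\le K}\hat\Delta_k\le\frac{\Phi_0+\tfrac12\mathcal S(1+\ln(K+1))}{\sqrt{K+1}}.$$
   Context: Norms: $\|\cdot\|$ is the Euclidean norm; $\|\cdot\|_{\mathrm{op}}$ is the operator norm; $D_{\mathcal X}=\max_{x,y\in\mathcal X}\|x-y\|$. Problem: $f:\mathcal X\to\mathbb R^n$ is differentiable with Jacobian $\nabla f(x)\in\mathbb R^{n\times d}$, $f(x)=\mathbb E_\xi[\tilde f(x;\xi)]$, and $\varphi(x)=F(f(x),x)$. All minima over $\mathcal X$ appearing are assumed attained. The generalized Frank--Wolfe gap at $y\in\mathcal X$ is $\hat\Delta(y)=\varphi(y)-\min_{x\in\mathcal X}F(f(y)+\nabla f(y)(x-y),x)$, and $\hat\Delta_k:=\hat\Delta(y_k)$. The composite curvature constant is $$\mathcal S=\sup_{x,y\in\mathcal X,\ \gamma\in(0,1]}\frac2{\gamma^2}\Big[F(f(y_\gamma),y_\gamma)-F\big(f(x)+\gamma\nabla f(x)(y-x),y_\gamma\big)\Big],\quad y_\gamma=x+\gamma(y-x).$$ Algorithm (Hybrid Momentum Stochastic Frank--Wolfe), with step sizes $\gamma_k,\beta_k,\rho_k\in(0,1]$ and $y_0\in\mathcal X$. The samples $\xi_0,\xi_1,\dots$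 are independent draws from the oracle distribution. Initialize $z_0=\tilde f(y_0;\xi_0)$, $V_0=\nabla\tilde f(y_0;\xi_0)$. For every $k\ge1$, at the current point $y_k$: - Jacobian tracker: $V_k=(1-\beta_k)V_{k-1}+\beta_k\nabla\tilde f(y_k;\xi_k)$; - function tracker, Variant I (Polyak): $z_k=(1-\rho_k)z_{k-1}+\rho_k\tilde f(y_k;\xi_k)$; Variant II (Taylor): $z_k=(1-\rho_k)[z_{k-1}+V_k(y_k-y_{k-1})]+\rho_k\tilde f(y_k;\xi_k)$. For every $k\ge0$: $x_{k+1}\in\arg\min_{x\in\mathcal X}F(z_k+V_k(x-y_k),x)$ and $y_{k+1}=(1-\gamma_k)y_k+\gamma_kx_{k+1}$. All equalities involving random quantities are understood almost surely.
   Formalization: Part (b) additionally assumes F(u,x) jointly convex in (u,x), as in (a); without it (b) fails, e.g. X=[0,1], f=(x-1/2)^2, F=u+8x(1-x), y_0=0. The oracle is taken jointly measurable and the choices x_{k+1} measurable and non-anticipating. *)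

(* Defs.v *)
(* MathComp-Analysis: vectors of R^d are the columns 'cV[R]_d, functions on X
   are total functions of which only the values on X matter. *)
From HB Require Export structures.
From mathcomp Require Export all_boot all_order all_algebra.
From mathcomp Require Export all_classical all_reals all_analysis.
Export Order.TTheory GRing.Theory Num.Theory.
Export numFieldNormedType.Exports.

Set Implicit Arguments.
Unset Strict Implicit.
Unset Printing Implicit Defensive.

#[global] Open Scope classical_set_scope.
#[global] Open Scope ring_scope.

Section Euclidean.
Context {R : realType}.

(* The library norm `|v| on matrices is the max norm, hence these two. *)
Definition enorm {d} (v : 'cV[R]_d) : R := Num.sqrt (\sum_i v i 0 ^+ 2).

Definition opnorm {n d} (A : 'M[R]_(n, d)) : R :=
  sup [set enorm (A *m v) | v in [set v : 'cV[R]_d | enorm v <= 1]].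

(* g is differentiable on X, relatively to X, with Jacobian J x at x. No
   neighbourhood of X is involved; if X has empty interior, J is one of the
   possible Jacobians. *)
Definition has_jacobian {n d} (X : set 'cV[R]_d)
    (g : 'cV[R]_d -> 'cV[R]_n) (J : 'cV[R]_d -> 'M[R]_(n, d)) : Prop :=
  forall x, X x -> forall e : R, 0 < e ->
    \forall y \near within X (nbhs x),
      enorm (g y - g x - J x *m (y - x)) <= e * enorm (y - x).

(* R^d with the sigma-algebra generated by its coordinates, i.e. its Borel
   sigma-algebra. *)
Definition borelcV (d : nat) : Type :=
  g_sigma_algebraType (g_sigma_preimage (fun (i : 'I_d) (v : 'cV[R]_d) => v i 0)).

End Euclidean.
Arguments borelcV R d : clear implicits.

Section Problem.
Context {R : realType} {d n : nat}.
Variables (X : set 'cV[R]_d) (F : 'cV[R]_n -> 'cV[R]_d -> R).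

Definition is_argmin (g : 'cV[R]_d -> R) (x : 'cV[R]_d) : Prop :=
  X x /\ forall x', X x' -> g x <= g x'.

Definition lipschitz_outer (LF : R) : Prop :=
  forall x, X x -> forall u v, `|F u x - F v x| <= LF * enorm (u - v).

Definition monotone_outer : Prop :=
  forall x, X x -> forall u v : 'cV[R]_n,
    (forall i, u i 0 <= v i 0) -> F u x <= F v x.

Definition subhomogeneous_outer : Prop :=
  forall x, X x -> forall u (c : R), 1 <= c -> F (c *: u) x <= c * F u x.

Definition jointly_convex_outer : Prop :=
  @convex_function R ('cV[R]_n * 'cV[R]_d)%type (setT `*` X)
    (fun p => F p.1 p.2).

Variables (f : 'cV[R]_d -> 'cV[R]_n) (J : 'cV[R]_d -> 'M[R]_(n, d)).

Definition convex_components : Prop :=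
  forall i, @convex_function R 'cV[R]_d X (fun x => f x i 0).

Definition objective (x : 'cV[R]_d) : R := F (f x) x.

Definition linearized (y x : 'cV[R]_d) : R := F (f y + J y *m (x - y)) x.

(* inf is the minimum over X under attained_gaps. *)
Definition fw_gap (y : 'cV[R]_d) : R :=
  objective y - inf [set linearized y x | x in X].

Definition attained_gaps : Prop :=
  forall y, X y -> exists x, is_argmin (linearized y) x.

(* sup is the real supremum: the set is bounded above as soon as X is bounded,
   J is Lipschitz and F is Lipschitz in its first argument. *)
Definition curvature : R :=
  sup [set s | exists x y (g : R), [/\ X x, X y, 0 < g <= 1 &
    let yg := x + g *: (y - x) in
    s = 2 / g ^+ 2 * (F (f yg) yg - F (f x + g *: (J x *m (y - x))) yg)]].

Definition basic_method (gamma : nat -> R) (y0 : 'cV[R]_d)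
    (x y : nat -> 'cV[R]_d) : Prop :=
  y 0%N = y0 /\
  forall k, is_argmin (linearized (y k)) (x k.+1) /\
    y k.+1 = (1 - gamma k) *: y k + gamma k *: x k.+1.

End Problem.

Definition in01 {R : realType} (s : nat -> R) : Prop := forall k, 0 < s k <= 1.

Variant tracker := Polyak | Taylor.

Section Algorithm.
Context {R : realType} {d n : nat} {Xi : Type}.
Variables (X : set 'cV[R]_d) (F : 'cV[R]_n -> 'cV[R]_d -> R).
Variables (ft : 'cV[R]_d -> Xi -> 'cV[R]_n).
Variables (Jt : 'cV[R]_d -> Xi -> 'M[R]_(n, d)).
Variables (t : tracker) (gamma beta rho : nat -> R) (y0 : 'cV[R]_d).

(* One trajectory, for a given realization xi of the samples; x 0 is unused. *)
Record hybrid_run (xi : nat -> Xi) (x y : nat -> 'cV[R]_d)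
    (z : nat -> 'cV[R]_n) (V : nat -> 'M[R]_(n, d)) : Prop := HybridRun {
  run_y0 : y 0%N = y0;
  run_z0 : z 0%N = ft y0 (xi 0%N);
  run_V0 : V 0%N = Jt y0 (xi 0%N);
  run_V : forall k, V k.+1 = (1 - beta k.+1) *: V k
            + beta k.+1 *: Jt (y k.+1) (xi k.+1);
  run_z : forall k, z k.+1 =
            match t with
            | Polyak => (1 - rho k.+1) *: z k
                          + rho k.+1 *: ft (y k.+1) (xi k.+1)
            | Taylor => (1 - rho k.+1) *: (z k + V k.+1 *m (y k.+1 - y k))
                          + rho k.+1 *: ft (y k.+1) (xi k.+1)
            end;
  run_x : forall k,
    is_argmin X (fun x' => F (z k + V k *m (x' - y k)) x') (x k.+1);
  run_y : forall k, y k.+1 = (1 - gamma k) *: y k + gamma k *: x k.+1 }.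

End Algorithm.

Section Oracle.
Context {R : realType} {d n : nat} {dXi : measure_display}
  {Xi : measurableType dXi}.
Variables (mu : probability Xi R) (X : set 'cV[R]_d).
Variables (f : 'cV[R]_d -> 'cV[R]_n) (J : 'cV[R]_d -> 'M[R]_(n, d)).
Variables (ft : 'cV[R]_d -> Xi -> 'cV[R]_n).
Variables (Jt : 'cV[R]_d -> Xi -> 'M[R]_(n, d)).

(* mu is the law of xi. Joint measurability in (x, xi) is what makes
   ft (y k) (xi k) a random variable when y k is random. *)
Record stochastic_oracle : Prop := StochasticOracle {
  oracle_measurable_fun : forall i,
    measurable_fun ((X : set (borelcV R d)) `*` setT)
      (fun p : borelcV R d * Xi => ft p.1 p.2 i 0);
  oracle_measurable_jac : forall i j,
    measurable_fun ((X : set (borelcV R d)) `*` setT)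
      (fun p : borelcV R d * Xi => Jt p.1 p.2 i j);
  oracle_jacobian : {ae mu, forall s, has_jacobian X (ft ^~ s) (Jt ^~ s)};
  oracle_integrable : forall x, X x -> forall i,
    mu.-integrable setT (fun s => (ft x s i 0)%:E);
  oracle_mean : forall x, X x -> forall i,
    ('E_mu[fun s => (ft x s i 0)%R] = (f x i 0)%:E)%E }.

Definition exact_oracle : Prop :=
  forall x, X x -> {ae mu, forall s, ft x s = f x /\ Jt x s = J x}.

Context {dO : measure_display} {Omega : measurableType dO}.
Variables (P : probability Omega R) (xi : nat -> Omega -> Xi)
  (x : nat -> Omega -> borelcV R d).

(* What is known when xi k is drawn: the earlier samples xi 0, ..., xi (k-1) and
   the earlier choices x 1, ..., x k in the argmin sets; they determine y k. *)
Definition history (k : nat) : set (set Omega) :=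
  <<s [set A | exists2 i, (i < k)%N &
         preimage_set_system setT (xi i) measurable A \/
         preimage_set_system setT (x i.+1) measurable A] >>.

(* Successive independent draws from mu. Independence of xi k from the history
   contains the mutual independence of the samples; the history also records the
   x i since an argmin need not be a singleton and ties may be broken by any
   non-anticipating rule, possibly randomized. *)
Record independent_draws : Prop := IndependentDraws {
  draws_measurable : forall k, measurable_fun setT (xi k);
  draws_law : forall k A, measurable A -> P (xi k @^-1` A) = mu A;
  choices_measurable : forall k, measurable_fun setT (x k.+1);
  draws_independent : forall k A B, history k A -> measurable B ->
    P (A `&` xi k @^-1` B) = (P A * P (xi k @^-1` B))%E }.

End Oracle.

(* Main.v *)
Require Import Defs.
From mathcomp Require Import measurable_realfun ring lra.

(** The point [y k] depends only on the first [k] choices, so it is independent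
    of the sample [xi k], and the joint law of [(y k, xi k)] is a product
    measure. For each fixed point of [X] the oracle errs on a null set of
    samples, hence by Fubini it almost surely does not err at [(y k, xi k)].
    Almost every trajectory is then one of the deterministic method.

    For that method, the curvature bound followed by joint convexity of [F] gives
    [phi (y k.+1) <= phi (y k) - gamma k * gap k + gamma k ^+ 2 / 2 * S].
    When [f] is convex too, monotonicity of [F] gives
    [phi (y k) - phi xs <= gap k] and (a) is an induction on [k]; summing over [k] gives (b). *)

Set Implicit Arguments.
Unset Strict Implicit.
Unset Printing Implicit Defensive.

(** * Norms and linearization error *)

Section euclidean_norm.
Context {R : realType}.

Lemma enorm_ge0 {d} (v : 'cV[R]_d) : 0 <= enorm v.
Proof. exact: sqrtr_ge0. Qed.

Lemma enorm0 {d} : enorm (0 : 'cV[R]_d) = 0.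
Proof. by rewrite /enorm big1 ?sqrtr0// => i _; rewrite mxE expr0n. Qed.

Lemma entry_le_enorm {d} (v : 'cV[R]_d) i : `|v i 0| <= enorm v.
Proof.
rewrite -sqrtr_sqr ler_sqrt ?sumr_ge0// => [|j _]; last exact: sqr_ge0.
by rewrite (bigD1 i)//= lerDl sumr_ge0// => j _; exact: sqr_ge0.
Qed.

Lemma enorm_le_sum {d} (v : 'cV[R]_d) : enorm v <= \sum_i `|v i 0|.
Proof.
have s0 : 0 <= \sum_i `|v i 0| by rewrite sumr_ge0.
rewrite -[leRHS](ger0_norm s0) -sqrtr_sqr ler_sqrt ?sqr_ge0//.
rewrite [leRHS]expr2 mulr_suml ler_sum// => i _.
rewrite -real_normK ?num_real// expr2 ler_wpM2l//.
by rewrite (bigD1 i)//= lerDl sumr_ge0.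
Qed.

Lemma enormZ {d} (a : R) (v : 'cV[R]_d) : enorm (a *: v) = `|a| * enorm v.
Proof.
rewrite /enorm -sqrtr_sqr -sqrtrM ?sqr_ge0// mulr_sumr; congr Num.sqrt.
by apply: eq_bigr => i _; rewrite mxE exprMn.
Qed.

Lemma enorm_eq0 {d} (v : 'cV[R]_d) : enorm v = 0 -> v = 0.
Proof.
move=> v0; apply/colP => i; rewrite mxE.
by apply/eqP; rewrite -normr_le0 -v0 entry_le_enorm.
Qed.

Lemma entry_le_norm {n d} (A : 'M[R]_(n, d)) i j : `|A i j| <= `|A|.
Proof.
by rewrite [leRHS]/Num.norm /= mx_normrE; apply/bigmax_geP; right; exists (i, j).
Qed.

(** Neighbourhoods and continuity on columns are those of the max norm; this carries Euclidean
    estimates over to them. *)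
Lemma enorm_le_norm {d} (v : 'cV[R]_d) : enorm v <= d%:R * `|v|.
Proof.
apply: (le_trans (enorm_le_sum v)).
rewrite -[X in _ <= X%:R * _]card_ord -sum1_card natr_sum mulr_suml.
by apply: ler_sum => i _; rewrite mul1r; exact: entry_le_norm.
Qed.

(** The real [sup] in [opnorm] bounds its set only once that set is known to be bounded; the sum of
    the absolute entries serves as a bound. *)
Lemma opnorm_set_has_ubound {n d} (A : 'M[R]_(n, d)) :
  has_ubound [set enorm (A *m v) | v in [set v : 'cV[R]_d | enorm v <= 1]].
Proof.
exists (\sum_i \sum_j `|A i j|) => _ [v v1 <-].
apply: (le_trans (enorm_le_sum _)); apply: ler_sum => i _.
rewrite mxE; apply: (le_trans (ler_norm_sum _ _ _)).
apply: ler_sum => j _; rewrite normrM ler_piMr//.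
exact: le_trans (entry_le_enorm v j) v1.
Qed.

Lemma enorm_mulmx_le {n d} (A : 'M[R]_(n, d)) (v : 'cV[R]_d) :
  enorm (A *m v) <= opnorm A * enorm v.
Proof.
have [v0|v0] := eqVneq (enorm v) 0.
  by rewrite (enorm_eq0 v0) mulmx0 !enorm0 mulr0.
have vp : 0 < enorm v by rewrite lt_neqAle eq_sym v0 enorm_ge0.
rewrite -ler_pdivrMr// mulrC -[X in X * _]ger0_norm ?invr_ge0 ?enorm_ge0//.
rewrite -enormZ scalemxAr; apply: ub_le_sup; first exact: opnorm_set_has_ubound.
by exists ((enorm v)^-1 *: v) => //=; rewrite enormZ gtr0_norm ?invr_gt0// mulVf.
Qed.

Lemma opnorm_ge0 {n d} (A : 'M[R]_(n, d)) : 0 <= opnorm A.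
Proof.
apply: ub_le_sup; first exact: opnorm_set_has_ubound.
by exists 0; rewrite /= ?mulmx0 enorm0.
Qed.

(** The unit vector [delta_mx j 0] is mapped to column [j], whose Euclidean norm dominates each of
    its entries. *)
Lemma entry_le_opnorm {n d} (A : 'M[R]_(n, d)) i j : `|A i j| <= opnorm A.
Proof.
have := enorm_mulmx_le A (delta_mx j 0).
rewrite -colE => /(le_trans (entry_le_enorm _ i)).
rewrite mxE => /le_trans; apply; rewrite ler_piMr ?opnorm_ge0//.
rewrite /enorm (bigD1 j)//= big1 ?mxE ?eqxx ?addr0 ?expr1n ?sqrtr1// => k kj.
by rewrite mxE (negPf kj) expr0n.
Qed.

End euclidean_norm.

(** * Derivatives relative to a convex set and the quadratic linearization bound *)

Section differentiation_on_convex_sets.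
Context {R : realType}.

Lemma near_withinP {V : normedModType R} (X : set V) (x : V) (Q : V -> Prop) :
  (\forall y \near within X (nbhs x), Q y) <->
  exists2 e : R, 0 < e & forall y, X y -> `|y - x| < e -> Q y.
Proof.
split=> [/nbhs_normP[e e0 eQ]|[e e0 eQ]].
  by exists e => // y Xy yx; apply: eQ => //=; rewrite distrC.
by apply/nbhs_normP; exists e => // y /= xy Xy; apply: eQ => //; rewrite distrC.
Qed.

Lemma locally_lipschitz_within_continuous {V : normedModType R} (X : set V)
    (g : V -> R) (M : V -> R) :
  (forall x, X x -> \forall y \near within X (nbhs x),
     `|g y - g x| <= M x * `|y - x|) ->
  {within X, continuous g}.
Proof.
move=> gM; apply/subspace_continuousP => x Xx.
have M1 : 0 < `|M x| + 1 by rewrite ltr_wpDl.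
apply/cvgrPdist_le => e e0.
have /near_withinP[c c0 cP] := gM x Xx.
apply/near_withinP; exists (Num.min c (e / (`|M x| + 1))).
  by rewrite lt_min c0 divr_gt0.
move=> y Xy; rewrite lt_min => /andP[yc ye].
rewrite distrC; apply: (le_trans (cP _ Xy yc)).
apply: (@le_trans _ _ ((`|M x| + 1) * `|y - x|)).
  by rewrite ler_wpM2r// (le_trans (ler_norm _))// lerDl.
by rewrite mulrC -ler_pdivlMr// ltW.
Qed.

Lemma convex_set_segment {V : lmodType R} (X : set V) (a b : V) (s : R) :
  convex_set X -> X a -> X b -> 0 <= s <= 1 -> X (a + s *: (b - a)).
Proof.
move=> cX Xa Xb /andP[s0 s1].
have -> : a + s *: (b - a) = s *: b + (1 - s) *: a.
  by rewrite scalerBl scale1r scalerBr addrCA.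
exact: set_mem (cX b a (Itv01 s0 s1) (mem_set Xb) (mem_set Xa)).
Qed.

Lemma convex_set_average {V : lmodType R} (X : set V) (a b : V) (s : R) :
  convex_set X -> X a -> X b -> 0 <= s <= 1 -> X ((1 - s) *: a + s *: b).
Proof.
move=> cX Xa Xb s01; have := convex_set_segment cX Xa Xb s01.
by rewrite scalerBl scale1r scalerBr -addrA [- _ + _]addrC.
Qed.

(** The remainder estimate gives a genuine derivative inside the interval and continuity up to the
    endpoints, which is what the mean value theorem asks for. *)
Lemma mean_value_bound (h dh : R -> R) (M : R) :
  (forall s : R, 0 <= s <= 1 -> forall e : R, 0 < e ->
    \forall r \near within `[0, 1] (nbhs s),
      `|h r - h s - dh s * (r - s)| <= e * `|r - s|) ->
  (forall s : R, 0 <= s <= 1 -> `|dh s| <= M) -> `|h 1 - h 0| <= M.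
Proof.
move=> hd dM.
have [s||s] := @MVT R h dh 0 1 ltr01.
- rewrite in_itv/= => /andP[s0 s1].
  have sI : 0 <= s <= 1 by rewrite !ltW.
  suff H : (fun k => k^-1 *: ((h \o shift s) (k *: 1) - h s)) @ 0^' --> dh s.
    by apply: DeriveDef; [exact: cvgP H|exact: cvg_lim H].
  apply/cvgrPdist_le => e e0.
  have /near_withinP[c c0 cP] := hd s sI e e0.
  near=> k.
  have k0 : k != 0 by near: k; exact: nbhs_dnbhs_neq.
  (* An increment below [s] and [1 - s] stays in the unit interval, so the relative estimate applies
     on both sides of [s]. *)
  have kc : `|k| < Num.min c (Num.min s (1 - s)).
    by near: k; apply: dnbhs0_lt; rewrite !lt_min c0 s0 subr_gt0.
  move: kc; rewrite !lt_min => /and3P[kc].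
  rewrite !ltr_norml => /andP[ks _] /andP[_ k1].
  have skI : `[0, 1]%classic (k + s) by rewrite /= in_itv/=; apply/andP; lra.
  have := cP _ skI; rewrite addrK => /(_ kc) H.
  rewrite /= [k *: 1]mulr1 -(ler_pM2r (_ : 0 < `|k|)) ?normr_gt0// -normrM.
  by rewrite mulrBl -[_ *: _]/(_ * _) mulrAC mulVf// mul1r distrC.
- apply: (@locally_lipschitz_within_continuous _ _ _ (fun s => `|dh s| + 1)).
  move=> s; rewrite /= in_itv/= => sI.
  have /near_withinP[c c0 cP] := hd s sI 1 ltr01.
  apply/near_withinP; exists c => // r rI rs.
  have := cP r rI rs.
  rewrite mulrDl -normrM => H.
  rewrite -[h r - h s](subrK (dh s * (r - s))) addrC.
  by apply: (le_trans (ler_normD _ _)); rewrite lerD2l.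
- rewrite in_itv/= => /andP[s0 s1]; rewrite subr0 mulr1 => ->.
  by apply: dM; rewrite !ltW.
Unshelve. all: by end_near. Qed.

Context {d n : nat} (X : set 'cV[R]_d).
Variables (f : 'cV[R]_d -> 'cV[R]_n) (J : 'cV[R]_d -> 'M[R]_(n, d)) (L : R).
Hypothesis f_jacobian : has_jacobian X f J.
Hypothesis J_lipschitz :
  forall a b, X a -> X b -> opnorm (J a - J b) <= L * enorm (a - b).

Lemma has_jacobian_continuous i : {within X, continuous (fun x => f x i 0)}.
Proof.
apply: (@locally_lipschitz_within_continuous _ _ _
  (fun x => (1 + opnorm (J x)) * d%:R)).
move=> x Xx; have /near_withinP[c c0 cP] := f_jacobian Xx ltr01.
apply/near_withinP; exists c => // y Xy yx.
have := le_trans (entry_le_enorm _ i) (cP _ Xy yx).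
rewrite 4!mxE => H.
have Jyx := le_trans (entry_le_enorm _ i) (enorm_mulmx_le (J x) (y - x)).
rewrite -mulrA; apply: (@le_trans _ _ ((1 + opnorm (J x)) * enorm (y - x))).
  rewrite -[f y i 0 - _](subrK ((J x *m (y - x)) i 0)).
  apply: (le_trans (ler_normD _ _)); rewrite mulrDl.
  by apply: lerD => //; move: H; rewrite !mxE.
rewrite ler_wpM2l ?enorm_le_norm//.
by rewrite addr_ge0// opnorm_ge0.
Qed.

Lemma lipschitz_jacobian_continuous i j :
  {within X, continuous (fun x => J x i j)}.
Proof.
apply: (@locally_lipschitz_within_continuous _ _ _ (fun=> `|L| * d%:R)).
move=> x Xx; apply/near_withinP; exists 1 => // y Xy _.
have := le_trans (entry_le_opnorm (J y - J x) i j) (J_lipschitz Xy Xx).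
rewrite !mxE => /le_trans; apply; rewrite -mulrA.
apply: (@le_trans _ _ (`|L| * enorm (y - x))).
  by rewrite ler_wpM2r ?enorm_ge0// ler_norm.
by rewrite ler_wpM2l// enorm_le_norm.
Qed.

(** Each component is restricted to the segment from [a] to [b] and its linear part subtracted; the
    derivative left over is controlled by the Lipschitz Jacobian. The factor [n] comes from summing
    components. The constant is not sharp: the bound serves only to show that the curvature set is
    bounded and in a limit along a segment. *)
Lemma linearization_error a b : convex_set X -> X a -> X b ->
  enorm (f b - f a - J a *m (b - a)) <= n%:R * (`|L| * enorm (b - a) ^+ 2).
Proof.
move=> cX Xa Xb; apply: (le_trans (enorm_le_sum _)).
rewrite -[X in _ <= X%:R * _]card_ord -sum1_card natr_sum mulr_suml.
apply: ler_sum => i _; rewrite mul1r.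
pose p (s : R) := a + s *: (b - a).
have pB s r : p r - p s = (r - s) *: (b - a).
  by rewrite /p scalerBl opprD addrACA subrr add0r.
pose h s := (f (p s) - s *: (J a *m (b - a))) i 0.
pose dh s := ((J (p s) - J a) *m (b - a)) i 0.
have Xp s : 0 <= s <= 1 -> X (p s) by exact: convex_set_segment.
have -> : (f b - f a - J a *m (b - a)) i 0 = h 1 - h 0.
  rewrite /h /p !scale1r !scale0r addr0 subr0 (addrC a) subrK.
  by rewrite !mxE addrAC.
apply: (@mean_value_bound h dh) => [s s01 e e0|s s01].
(* The tolerance [e / N] becomes at most [e] after multiplication by the length of the segment;
   adding 1 covers [a = b]. *)
- set N := enorm (b - a) + 1.
  have N0 : 0 < N by rewrite ltr_wpDl// enorm_ge0.
  have /near_withinP[c c0 cP] := f_jacobian (Xp s s01) (divr_gt0 e0 N0).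
  have M0 : 0 < `|b - a| + 1 by rewrite ltr_wpDl.
  apply/near_withinP; exists (c / (`|b - a| + 1)); first by rewrite divr_gt0.
  move=> r /=; rewrite in_itv/= => r01 rs.
  have := cP _ (Xp r r01); rewrite pB normrZ => /(_ _)/wrap[].
    apply: (@le_lt_trans _ _ (`|r - s| * (`|b - a| + 1))).
      by rewrite ler_wpM2l// lerDl.
    by rewrite -ltr_pdivlMr.
  move/(le_trans (entry_le_enorm _ i)) => H.
  have -> : h r - h s - dh s * (r - s)
      = (f (p r) - f (p s) - J (p s) *m ((r - s) *: (b - a))) i 0.
    rewrite /h /dh mulmxBl -scalemxAr !mxE; ring.
  apply: (le_trans H); rewrite enormZ -mulrA ler_wpM2l//; first exact: ltW.
  rewrite mulrCA ler_piMr// mulrC ler_pdivrMr// mul1r.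
  by rewrite lerDl.
- apply: (le_trans (entry_le_enorm _ i)).
  apply: (le_trans (enorm_mulmx_le _ _)).
  rewrite expr2 mulrA ler_wpM2r ?enorm_ge0//.
  apply: (le_trans (J_lipschitz (Xp s s01) Xa)).
  have -> : p s - a = s *: (b - a) by rewrite /p addrC addKr.
  case/andP: s01 => s0 s1.
  rewrite enormZ (ger0_norm s0).
  apply: (@le_trans _ _ (`|L| * (s * enorm (b - a)))).
    by rewrite ler_wpM2r ?ler_norm// mulr_ge0// enorm_ge0.
  by rewrite ler_wpM2l// ler_piMl// enorm_ge0.
Qed.

End differentiation_on_convex_sets.

(** * The deterministic method *)

Section real_sequences.
Context {R : realType}.

(** The induction starts at index 1: the step at [k = 0] has weight 1, so the initial value [h 0]
    drops out. *)
Lemma convex_rate (h : nat -> R) (S : R) : 0 <= S ->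
  (forall k, h k.+1 <= (1 - 2 / (k%:R + 2)) * h k
     + (2 / (k%:R + 2)) ^+ 2 / 2 * S) ->
  forall K, (1 <= K)%N -> h K <= 2 * S / (K%:R + 1).
Proof.
move=> S0 hS [//|K] _; elim: K => [|K IH].
  apply: (le_trans (hS 0)); rewrite !add0r.
  have -> : 1 - 2 / 2 = 0 :> R by field.
  have -> : 2 / 2 = 1 :> R by field.
  by rewrite mul0r add0r (_ : 1 + 1 = 2)//; lra.
apply: (le_trans (hS _)).
have K0 : 0 <= K%:R :> R by [].
have E1 : K.+1%:R = K%:R + 1 :> R by rewrite natr1.
have E2 : K.+2%:R = K%:R + 1 + 1 :> R by rewrite -E1 natr1.
rewrite E2 E1; rewrite E1 in IH; set k := K%:R in K0 IH *.
have g0 : 0 <= 1 - 2 / (k + 1 + 2).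
  by rewrite subr_ge0 ler_pdivrMr ?mul1r; lra.
apply: (@le_trans _ _ ((1 - 2 / (k + 1 + 2)) * (2 * S / (k + 1 + 1))
    + (2 / (k + 1 + 2)) ^+ 2 / 2 * S)).
  by rewrite lerD2r ler_wpM2l.
rewrite -subr_ge0.
(* The slack of the induction step in closed form, visibly nonnegative. *)
have -> : 2 * S / (k + 1 + 1 + 1) - ((1 - 2 / (k + 1 + 2)) * (2 * S / (k + 1 + 1))
    + (2 / (k + 1 + 2)) ^+ 2 / 2 * S)
  = 2 * S / ((k + 2) * (k + 3) ^+ 2).
  by field; rewrite !gt_eqF//; lra.
by rewrite divr_ge0 ?mulr_ge0 ?exprn_ge0//; lra.
Qed.

Lemma harmonic_sum_le_ln n :
  \sum_(0 <= k < n.+1) (k%:R + 1)^-1 <= 1 + ln (n%:R + 1) :> R.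
Proof.
elim: n => [|n IH]; first by rewrite big_nat1 !add0r ln1 invr1 addr0.
rewrite big_nat_recr//= -[n.+1%:R]natr1.
have n0 : 0 <= n%:R :> R by [].
apply: (le_trans (lerD IH (lexx _))); rewrite -addrA lerD2l -lerBrDl.
rewrite -opprB lerNr -ln_div ?posrE; [|lra|lra].
have -> : (n%:R + 1) / (n%:R + 1 + 1) = 1 - (n%:R + 1 + 1)^-1 :> R.
  by field; rewrite gt_eqF//; lra.
(* The bound [ln (1 + x) <= x] at [x = - 1 / (n + 2)] bounds the new term by an increment of the
   logarithm. *)
by apply: le_ln1Dx; rewrite ltrN2 invf_lt1//; lra.
Qed.

Lemma sum_ge_min (g D : nat -> R) (m : R) n : (forall k, 0 <= g k) ->
  (forall k, (k < n)%N -> m <= D k) ->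
  m * \sum_(0 <= k < n) g k <= \sum_(0 <= k < n) g k * D k.
Proof.
move=> g0 mD; rewrite mulr_sumr big_nat_cond [leRHS]big_nat_cond ler_sum//.
by move=> k /andP[/andP[_ kn] _]; rewrite mulrC ler_wpM2l ?mD.
Qed.

End real_sequences.

(** * Curvature, generalized gap and descent *)

Section generalized_frank_wolfe.
Context {R : realType} {d n : nat}.
Variables (X : set 'cV[R]_d) (F : 'cV[R]_n -> 'cV[R]_d -> R) (LF L : R).
Variables (f : 'cV[R]_d -> 'cV[R]_n) (J : 'cV[R]_d -> 'M[R]_(n, d)).
Hypothesis X_convex : convex_set X.
Hypothesis X_compact : compact X.
Hypothesis F_lipschitz : lipschitz_outer X F LF.
Hypothesis F_monotone : monotone_outer X F.
Hypothesis f_jacobian : has_jacobian X f J.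
Hypothesis J_lipschitz :
  forall a b, X a -> X b -> opnorm (J a - J b) <= L * enorm (a - b).

Lemma enorm_sub_bounded : exists D, forall a b, X a -> X b -> enorm (b - a) <= D.
Proof.
have [M [_ MX]] := compact_bounded X_compact.
(* Boundedness holds for every value strictly above [M], hence [M + 1] for each point; [d] converts
   the max norm to the Euclidean one. *)
exists (d%:R * (M + 1 + (M + 1))) => a b Xa Xb.
apply: (le_trans (enorm_le_norm _)); rewrite ler_wpM2l//.
apply: (le_trans (ler_normB _ _)).
by apply: lerD; apply: MX => //; rewrite ltrDl.
Qed.

(** The linearization error at [yg] is of order [g ^+ 2], which cancels the factor [2 / g ^+ 2];
    with [F] Lipschitz and [X] bounded, the set under the supremum is bounded above. *)
Lemma curvature_ub a b g : X a -> X b -> 0 < g <= 1 ->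
  let yg := a + g *: (b - a) in
  2 / g ^+ 2 * (F (f yg) yg - F (f a + g *: (J a *m (b - a))) yg)
    <= curvature X F f J.
Proof.
move=> Xa Xb g01 /=; apply: ub_le_sup; last by exists a, b, g.
have [D DX] := enorm_sub_bounded.
exists (2 * (`|LF| * (n%:R * (`|L| * D ^+ 2)))).
move=> _ [x [y [e [Xx Xy e01 ->]]]] /=; move: e01 => /andP[e0 e1].
set ye := x + e *: (y - x).
have Xye : X ye by apply: convex_set_segment => //; rewrite e1 ltW.
rewrite -mulrA ler_wpM2l// ler_pdivrMl ?exprn_gt0//.
apply: (le_trans (ler_norm _)); apply: (le_trans (F_lipschitz Xye _ _)).
have yeB : ye - x = e *: (y - x) by rewrite /ye addrC addKr.
have := linearization_error f_jacobian J_lipschitz X_convex Xx Xye.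
rewrite yeB -scalemxAr enormZ exprMn (gtr0_norm e0) opprD addrA => err.
apply: (@le_trans _ _ (`|LF| * (n%:R * (`|L| * (e ^+ 2 * enorm (y - x) ^+ 2))))).
  apply: (le_trans (ler_wpM2r (enorm_ge0 _) (ler_norm _))).
  by rewrite ler_wpM2l.
rewrite [leRHS](_ : _ =
  `|LF| * (n%:R * (`|L| * (e ^+ 2 * D ^+ 2)))); last by ring.
do 3!rewrite ler_wpM2l//.
rewrite ler_pM2l ?exprn_gt0//.
by rewrite lerXn2r// ?nnegrE ?enorm_ge0 ?(le_trans (enorm_ge0 (y - x)))// DX.
Qed.

Lemma curvature_ge0 a : X a -> 0 <= curvature X F f J.
Proof.
move=> Xa; have := @curvature_ub a a 1 Xa Xa; rewrite ltr01 lexx => /(_ isT).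
by rewrite /= subrr mulmx0 !scaler0 !addr0 subrr mulr0.
Qed.

(** The curvature bound solved for the new objective value, with the linear model written as an
    average of [f a] and the full linearization at [b], the form to which joint convexity
    applies. *)
Lemma curvature_step a b g : X a -> X b -> 0 < g <= 1 ->
  let yg := (1 - g) *: a + g *: b in
  objective F f yg <= F ((1 - g) *: f a + g *: (f a + J a *m (b - a))) yg
                      + g ^+ 2 / 2 * curvature X F f J.
Proof.
move=> Xa Xb g01 /=; set yg := (1 - g) *: a + g *: b.
have := curvature_ub Xa Xb g01 => /=.
have -> : a + g *: (b - a) = yg.
  by rewrite /yg scalerBl scale1r scalerBr -addrA [- _ + _]addrC.
have -> : f a + g *: (J a *m (b - a))
    = (1 - g) *: f a + g *: (f a + J a *m (b - a)).
  by rewrite scalerDr addrA -scalerDl subrK scale1r.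
case/andP: g01 => g0 _.
rewrite -ler_pdivlMl ?divr_gt0 ?exprn_gt0// lerBlDl invf_div.
by rewrite /objective.
Qed.

Lemma is_argmin_inf (g : 'cV[R]_d -> R) x :
  is_argmin X g x -> inf [set g y | y in X] = g x.
Proof.
move=> [Xx gx]; apply/eqP; rewrite eq_le; apply/andP; split.
  by apply: ge_inf; [exists (g x) => _ [y Xy <-]; exact: gx|exists x].
by apply: lb_le_inf => [|_ [y Xy <-]]; [exists (g x), x|exact: gx].
Qed.

Lemma fw_gapE a b : is_argmin X (linearized F f J a) b ->
  fw_gap X F f J a = objective F f a - linearized F f J a b.
Proof. by move=> /is_argmin_inf <-. Qed.

Lemma fw_gap_ge a b x : is_argmin X (linearized F f J a) b -> X x ->
  objective F f a - linearized F f J a x <= fw_gap X F f J a.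
Proof.
by move=> ab Xx; rewrite (fw_gapE ab) lerD2l lerN2; case: ab => _; exact.
Qed.

(** The point [a] itself competes in the minimum, and its linearized value is the objective. *)
Lemma fw_gap_ge0 a b : X a -> is_argmin X (linearized F f J a) b ->
  0 <= fw_gap X F f J a.
Proof.
move=> Xa /fw_gap_ge /(_ Xa); apply: le_trans.
by rewrite /linearized subrr mulmx0 addr0 subrr.
Qed.

Lemma jointly_convex_outer_le u v a b g : jointly_convex_outer X F ->
  X a -> X b -> 0 <= g <= 1 ->
  F ((1 - g) *: u + g *: v) ((1 - g) *: a + g *: b)
    <= (1 - g) * F u a + g * F v b.
Proof.
move=> cF Xa Xb /andP[g0 g1].
(* In [convex_function] the weight [g] goes to the first point, hence the swapped order. *)
have := cF (Itv01 g0 g1) (v, b) (u, a).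
rewrite !inE => /(_ (conj I Xb) (conj I Xa)) H.
by rewrite ![_ + g *: _]addrC; exact: H.
Qed.

Lemma frank_wolfe_step a b g : jointly_convex_outer X F ->
  X a -> is_argmin X (linearized F f J a) b -> 0 < g <= 1 ->
  objective F f ((1 - g) *: a + g *: b)
    <= objective F f a - g * fw_gap X F f J a + g ^+ 2 / 2 * curvature X F f J.
Proof.
move=> cF Xa ab /andP[g0 g1]; have [Xb _] := ab.
apply: (le_trans (curvature_step Xa Xb _)); first by rewrite g0.
rewrite lerD2r.
apply: (le_trans (jointly_convex_outer_le _ _ cF Xa Xb _)); first by rewrite ltW.
rewrite (fw_gapE ab) le_eqVlt; apply/orP; left; apply/eqP.
rewrite /objective /linearized; ring.
Qed.

Lemma convex_components_linear a x : convex_components X f ->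
  X a -> X x -> forall i, (f a + J a *m (x - a)) i 0 <= f x i 0.
Proof.
move=> cf Xa Xx i.
apply/ler_addgt0Pl => e e0.
(* The linearization error at [a + s *: (x - a)] is [s ^+ 2 * C], so after
   division by [s] it is at most [e] for small [s]. *)
pose C := n%:R * (`|L| * enorm (x - a) ^+ 2).
have C0 : 0 <= C by rewrite 2?mulr_ge0// exprn_ge0 ?enorm_ge0.
pose s := Num.min 1 (e / (C + 1)).
have s0 : 0 < s by rewrite lt_min ltr01 divr_gt0// ltr_wpDl.
have s1 : s <= 1 by rewrite ge_min lexx.
have sC : s * C <= e.
  apply: (@le_trans _ _ (s * (C + 1))); first by rewrite ler_pM2l// lerDl.
  by rewrite -ler_pdivlMr ?ltr_wpDl// ge_min lexx orbT.
have s01 : 0 <= s <= 1 by rewrite s1 ltW.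
have Xs := convex_set_segment X_convex Xa Xx s01.
have sB : a + s *: (x - a) - a = s *: (x - a) by rewrite addrC addKr.
have := linearization_error f_jacobian J_lipschitz X_convex Xa Xs.
move=> /(le_trans (entry_le_enorm _ i)).
rewrite sB enormZ (gtr0_norm s0) exprMn -scalemxAr.
rewrite (_ : n%:R * _ = s * (s * C)); last by rewrite /C; ring.
rewrite ler_norml => /andP[+ _].
(* Convexity bounds component [i] at the intermediate point from above, the linearization error from
   below; comparing the two yields the goal multiplied by [s]. *)
have : f (a + s *: (x - a)) i 0 <= s * f x i 0 + (1 - s) * f a i 0.
  have -> : a + s *: (x - a) = s *: x + (1 - s) *: a.
    by rewrite scalerBl scale1r scalerBr addrCA.
  exact: cf i (Itv01 (ltW s0) s1) x a (mem_set Xx) (mem_set Xa).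
rewrite !mxE => H1 H2; rewrite -(ler_pM2l s0).
have : s * (s * C) <= s * e by rewrite ler_pM2l.
by move: H1 H2; lra.
Qed.

Lemma convex_gap_le a b xs : convex_components X f -> X a -> X xs ->
  is_argmin X (linearized F f J a) b ->
  objective F f a - objective F f xs <= fw_gap X F f J a.
Proof.
move=> cf Xa Xxs ab; apply: le_trans (fw_gap_ge ab Xxs).
rewrite lerD2l lerN2; apply: F_monotone => // i.
exact: convex_components_linear.
Qed.

Section basic_method_rates.
Variables (gamma : nat -> R) (y0 : 'cV[R]_d) (x y : nat -> 'cV[R]_d).
Hypothesis gamma01 : in01 gamma.
Hypothesis X_y0 : X y0.
Hypothesis run : basic_method X F f J gamma y0 x y.
Hypothesis cF : jointly_convex_outer X F.

Lemma basic_method_feasible k : X (y k).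
Proof.
have [y0E yP] := run.
elim: k => [|k IH]; first by rewrite y0E.
have [[Xx _] ->] := yP k.
have /andP[g0 g1] := gamma01 k.
by apply: convex_set_average => //; rewrite g1 ltW.
Qed.

Lemma basic_method_descent k :
  objective F f (y k.+1) <= objective F f (y k)
    - gamma k * fw_gap X F f J (y k) + gamma k ^+ 2 / 2 * curvature X F f J.
Proof.
have [xk ->] := run.2 k.
by apply: frank_wolfe_step => //; exact: basic_method_feasible.
Qed.

Lemma basic_method_convex_rate xs : convex_components X f ->
  (forall k, gamma k = 2 / (k%:R + 2)) -> is_argmin X (objective F f) xs ->
  forall K, (1 <= K)%N ->
  objective F f (y K) - objective F f xs
    <= 2 * curvature X F f J / (K%:R + 1).
Proof.
move=> cf gE [Xxs _].
pose h k := objective F f (y k) - objective F f xs.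
apply: (@convex_rate _ h) => [|k]; first exact: curvature_ge0 X_y0.
have [xk _] := run.2 k; have /andP[g0 _] := gamma01 k.
have := basic_method_descent k.
have := convex_gap_le cf (basic_method_feasible k) Xxs xk.
rewrite -(ler_pM2l g0) -gE /h.
set T := gamma k ^+ 2 / 2 * _.
by lra.
Qed.

Lemma basic_method_gap_sum K :
  \sum_(0 <= k < K) gamma k * fw_gap X F f J (y k) <=
  objective F f y0 - objective F f (y K)
    + curvature X F f J / 2 * \sum_(0 <= k < K) gamma k ^+ 2.
Proof.
elim: K => [|K IH].
  by have [<- _] := run; rewrite !big_geq// subrr mulr0 addr0.
rewrite !big_nat_recr//=; have := basic_method_descent K.
move: IH; set s1 := \sum_(_ <= _ < _) _; set s2 := \sum_(_ <= _ < _) _.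
by lra.
Qed.

Lemma basic_method_nonconvex_rate xs :
  (forall k, gamma k = 1 / Num.sqrt (k%:R + 1)) ->
  is_argmin X (objective F f) xs ->
  forall K,
  \big[Num.min/fw_gap X F f J (y 0%N)]_(k < K.+1) fw_gap X F f J (y k)
    <= (objective F f y0 - objective F f xs
        + 1 / 2 * curvature X F f J * (1 + ln (K%:R + 1)))
       / Num.sqrt (K%:R + 1).
Proof.
move=> gE [Xxs xsP] K.
set m := \big[_/_]_(_ < _) _; set S := curvature X F f J.
have K1 : 0 < K%:R + 1 :> R by rewrite ltr_wpDl.
have sK : 0 < Num.sqrt (K%:R + 1 : R) by rewrite sqrtr_gt0.
have gap0 k : 0 <= fw_gap X F f J (y k).
  by have [xk _] := run.2 k; apply: fw_gap_ge0 xk; exact: basic_method_feasible.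
(* The default value of the minimum is the gap at [y 0], already one of its terms. Nonnegativity of
   [m] allows the step-size sum to be replaced by its lower bound. *)
have m0 : 0 <= m by apply: le_bigmin.
have mD k : (k < K.+1)%N -> m <= fw_gap X F f J (y k).
  by move=> kK; exact: (@bigmin_le_cond _ _ _ _ (Ordinal kK)).
have g0 k : 0 <= gamma k by case/andP: (gamma01 k) => /ltW.
rewrite ler_pdivlMr//.
(* Each of the [K + 1] step sizes is at least the last one, [1 / Num.sqrt (K%:R + 1)]. *)
have gsum : Num.sqrt (K%:R + 1) <= \sum_(0 <= k < K.+1) gamma k.
  have -> : Num.sqrt (K%:R + 1)
      = \sum_(0 <= k < K.+1) 1 / Num.sqrt (K%:R + 1) :> R.
    rewrite sumr_const_nat subn0 -[RHS]mulr_natl -natr1 mul1r.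
    by rewrite -{2}[K%:R + 1]sqr_sqrtr ?ltW// expr2 mulfK// gt_eqF.
  rewrite big_nat_cond [leRHS]big_nat_cond; apply: ler_sum => k.
  move=> /andP[/andP[_ kK] _]; rewrite gE !mul1r.
  rewrite lef_pV2 ?posrE ?sqrtr_gt0 ?ltr_wpDl//.
  by rewrite ler_sqrt ?addr_ge0// lerD2r ler_nat.
have g2 : \sum_(0 <= k < K.+1) gamma k ^+ 2 <= 1 + ln (K%:R + 1).
  apply: le_trans (harmonic_sum_le_ln K); rewrite le_eqVlt; apply/orP; left.
  apply/eqP; apply: eq_bigr => k _.
  by rewrite gE mul1r exprVn sqr_sqrtr// addr_ge0.
have := sum_ge_min g0 mD.
have := basic_method_gap_sum K.+1.
have S0 : 0 <= S by exact: curvature_ge0 X_y0.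
have := ler_wpM2l m0 gsum.
have := ler_wpM2l S0 g2.
(* Summing the gaps up to index [K] telescopes to the objective at [y K.+1], which is at least the
   optimal value. *)
have := xsP _ (basic_method_feasible K.+1).
rewrite -/S; set A := \sum_(_ <= _ < _) _; set B := \sum_(_ <= _ < _) _.
by lra.
Qed.

End basic_method_rates.
End generalized_frank_wolfe.

(** * Exactness of the oracle at the iterates *)

Section borel_columns.
Context {R : realType} {d : nat}.

Lemma measurable_coordinate (i : 'I_d) :
  measurable_fun setT (fun v : borelcV R d => v i 0).
Proof.
case: d i => [[] []//|m i] _ A mA; apply: sub_sigma_algebra => /=.
apply: sub_sigma_algebra.
rewrite -bigcup_mkord_ord; exists i; first exact: ltn_ord.
by exists A => //; rewrite inord_val.
Qed.

Lemma measurable_fun_coordinates dT (T : measurableType dT)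
    (g : T -> borelcV R d) :
  (forall i, measurable_fun setT (fun w => g w i 0)) -> measurable_fun setT g.
Proof.
move=> mg; pose G m := \big[setU/set0]_(i < m)
  preimage_set_system setT (fun v : 'cV[R]_m => v i 0) measurable.
have mG A : G d A -> measurable (g @^-1` A).
  case: d g mg A => [|m] g mg A; first by rewrite /G big_ord0.
  rewrite /G -bigcup_mkord_ord => -[i _ [B mB <-]].
  by rewrite setTI -comp_preimage -[X in measurable X]setTI; exact: mg.
(* [g_sigma_preimage] is already a sigma-algebra, so generating once more changes nothing and [G d]
   generates. *)
have bE : @measurable _ (borelcV R d) = <<s G d >>.
  by apply: sigma_algebra_id; exact: smallest_sigma_algebra.
by apply: (measurability _ bE) => _ [A GA <-]; rewrite setTI; exact: mG.
Qed.

(** Boxes [B] with rational centre and radius [1 / (m + 1)] form a countable base; an open set is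
    the union of the boxes it contains, the others being replaced by [set0]. *)
Lemma open_measurable_borelcV (O : set 'cV[R]_d) :
  open O -> measurable (O : set (borelcV R d)).
Proof.
move=> oO.
pose B (p : 'cV[rat]_d * nat) : set 'cV[R]_d :=
  [set v | forall i, `|v i 0 - ratr (p.1 i 0)| < p.2.+1%:R^-1].
have mB p : measurable (B p : set (borelcV R d)).
  have -> : B p = \bigcap_(i in [set: 'I_d])
      [set v | `|v i 0 - ratr (p.1 i 0)| < p.2.+1%:R^-1].
    by apply/seteqP; split=> v Bv // i; [move=> _; exact: Bv|exact: Bv].
  apply: fin_bigcap_measurable => // i _.
  have mi : measurable_fun setT
      (fun v : borelcV R d => `|v i 0 - ratr (p.1 i 0)|).
    apply: measurableT_comp => //; apply: measurable_funB => //.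
    exact: measurable_coordinate.
  have := mi measurableT _ (measurable_itv `]-oo, p.2.+1%:R^-1[).
  by rewrite setTI.
have -> : O = \bigcup_p (if `[< B p `<=` O >] then B p else set0).
  apply/seteqP; split => [v Ov|v [p _]]; last by case: asboolP => [|//]; exact.
  have /nbhs_ballP[e /= e0 eO] := open_nbhs_nbhs (conj oO Ov).
  (* Any two points of a box of radius below [e / 2] are within [e] coordinatewise, so a box around
     [v] lies in the ball. *)
  have [N Ne] : exists N : nat, N.+1%:R^-1 < e / 2.
    have := @ltr_add_invr R 0 (e / 2); rewrite divr_gt0// => /(_ isT)[N].
    by rewrite add0r; exists N.
  have q_ i : exists q : rat, `|v i 0 - ratr q| < N.+1%:R^-1.
    have /rat_in_itvoo[q] : v i 0 - N.+1%:R^-1 < v i 0 + N.+1%:R^-1.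
      by rewrite ltrD2l gtrN// invr_gt0.
    by rewrite in_itv/= => q_; exists q; rewrite distrC ltr_distl.
  have [q qP] := choice q_.
  exists (\col_i q i, N) => //.
  have Bv : B (\col_i q i, N) v by move=> i; rewrite mxE.
  rewrite ifT//; apply/asboolP => u Bu; apply: eO; split=> // i j.
  rewrite ord1 /ball/= -[v i 0](subrK (ratr (q i))) -addrA.
  apply: (le_lt_trans (ler_normD _ _)); rewrite (splitr e).
  have := Bu i; have := Bv i; rewrite mxE/= => Bvi Bui.
  by apply: ltrD; [|rewrite distrC]; exact: lt_trans Ne.
apply: countable_bigcupT_measurable => [|p]; first exact: countableP.
by case: ifP.
Qed.

Lemma closed_measurable_borelcV (C : set 'cV[R]_d) :
  closed C -> measurable (C : set (borelcV R d)).
Proof.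
by move=> /closed_openC/open_measurable_borelcV/measurableC; rewrite setCK.
Qed.

Lemma within_continuous_measurable_borelcV (X : set 'cV[R]_d)
    (g : 'cV[R]_d -> R) :
  {within X, continuous g} -> measurable_fun (X : set (borelcV R d)) g.
Proof.
move=> cg mX.
apply: (measurability _ (RGenOpens.measurableE R)) => //.
move=> _ [_ [a [b ->] <-]].
have : open ((g : subspace X -> R) @^-1` `]a, b[).
  by move/continuousP: cg; apply; exact: interval_open.
move=> /open_subspaceP[V oV VX].
by rewrite setIC -VX; apply: measurableI => //; exact: open_measurable_borelcV.
Qed.

End borel_columns.

(** * Almost sure identities for an independent pair *)

Section independent_pair.
Context {R : realType} {dO d1 d2 : measure_display}.
Context {Omega : measurableType dO} {T1 : measurableType d1}
  {T2 : measurableType d2}.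
Variables (P : probability Omega R) (mu : probability T2 R).
Variables (Y : Omega -> T1) (xi : Omega -> T2).
Hypothesis mY : measurable_fun setT Y.
Hypothesis mxi : measurable_fun setT xi.
Hypothesis indep : forall A B, measurable A -> measurable B ->
  P (Y @^-1` A `&` xi @^-1` B) = (P (Y @^-1` A) * mu B)%E.

(** Independence fixes the joint law on rectangles, so it is the product measure, which integrates
    the measures of the sections. [Y] and the pair are bundled as measurable functions so that
    [distribution] applies. *)
Lemma independent_pair_null (N : set (T1 * T2)) : measurable N ->
  (forall a, mu (xsection N a) = 0%E) ->
  P ((fun w => (Y w, xi w)) @^-1` N) = 0%E.
Proof.
move=> mN N0.
pose Y' : {mfun Omega >-> T1} := HB.pack Y (isMeasurableFun.Build _ _ _ _ Y mY).
have mYxi : measurable_fun setT (fun w => (Y w, xi w)).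
  exact: measurable_fun_pair.
pose Z' : {mfun Omega >-> (T1 * T2)%type} :=
  HB.pack (fun w => (Y w, xi w)) (isMeasurableFun.Build _ _ _ _ _ mYxi).
apply: (etrans (esym (@product_measure_unique _ _ _ _ R (distribution P Y') mu
  (distribution P Z') indep N mN))).
by rewrite /product_measure1 integral0_eq// => a _; exact: N0.
Qed.

Lemma independent_pair_ae_eq (X : set T1) (g : T1 -> T2 -> R) (h : T1 -> R) :
  measurable X ->
  measurable_fun (X `*` setT) (fun p : T1 * T2 => g p.1 p.2) ->
  measurable_fun X h ->
  (forall a, X a -> {ae mu, forall s, g a s = h a}) ->
  {ae P, forall w, X (Y w) -> g (Y w) (xi w) = h (Y w)}.
Proof.
move=> mX mg mh gh.
(* The set of errors, cut down to [X], where measurability and almost sure equality are assumed; its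
   sections off [X] are empty. *)
pose N := (X `*` [set: T2]) `&` [set p | g p.1 p.2 == h p.1 = false].
have mXT : measurable (X `*` [set: T2]) by exact: measurableX.
have mN : measurable N.
  have mh1 : measurable_fun (X `*` [set: T2]) (fun p => h p.1).
    apply: (measurable_comp mX) => //; first by move=> _ [p [Xp _] <-].
    exact: measurable_funTS.
  have mF : measurable [set false] by [].
  exact: (measurable_fun_eqr mg mh1 mXT mF).
have N0 a : mu (xsection N a) = 0%E.
  have [Xa|nXa] := pselect (X a); last first.
    rewrite (_ : xsection N a = set0) ?measure0//.
    by apply/seteqP; split => // s /xsectionP[[]].
  apply: measure_negligible; first exact: measurable_xsection.
  apply: negligibleS (gh a Xa) => s /xsectionP[_ /= gs] gsE.
  by rewrite gsE eqxx in gs.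
exists ((fun w => (Y w, xi w)) @^-1` N); split.
- rewrite -[X in measurable X]setTI.
  exact: (measurable_fun_pair mY mxi).
- exact: independent_pair_null.
- move=> w /= /not_implyP[XY gY]; split => //=.
  by apply/negbTE/eqP.
Qed.

End independent_pair.

Section iterates.
Context {R : realType} {d : nat}.

(** The iterates as an explicit function of the choices. The process [y] agrees with it only almost
    surely, whereas this version is measurable everywhere and with respect to the history. *)
Fixpoint averaged {T : Type} (gamma : nat -> R) (y0 : 'cV[R]_d)
    (x : nat -> T -> 'cV[R]_d) (k : nat) (w : T) : 'cV[R]_d :=
  if k is k'.+1
  then (1 - gamma k') *: averaged gamma y0 x k' w + gamma k' *: x k'.+1 w
  else y0.

Lemma measurable_averaged dT (T : measurableType dT) (gamma : nat -> R)
    (y0 : 'cV[R]_d) (x : nat -> T -> borelcV R d) m :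
  (forall k, (k < m)%N -> measurable_fun setT (x k.+1)) ->
  forall k, (k <= m)%N ->
  measurable_fun setT (averaged gamma y0 x k : T -> borelcV R d).
Proof.
move=> mx k km; apply: measurable_fun_coordinates => i.
elim: k km => [|k IH] km; first exact: measurable_cst.
rewrite (_ : (fun _ => _) = (fun w => (1 - gamma k) * averaged gamma y0 x k w i 0
  + gamma k * x k.+1 w i 0)); last by apply/funext => w; rewrite /= !mxE.
apply: measurable_funD; apply: measurable_funM => //.
  by apply: IH; exact: ltnW.
apply: (measurableT_comp (measurable_coordinate i)); exact: mx.
Qed.

End iterates.

Section exactness_at_random_iterates.
Context {R : realType} {d : nat} {dXi dO : measure_display}
  {Xi : measurableType dXi} {Omega : measurableType dO}.
Variables (mu : probability Xi R) (P : probability Omega R) (X : set 'cV[R]_d).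
Variables (xi : nat -> Omega -> Xi) (x : nat -> Omega -> borelcV R d).
Hypothesis draws : independent_draws mu P xi x.
Variables (gamma : nat -> R) (y0 : 'cV[R]_d).

Lemma exact_at_iterates k (g : borelcV R d -> Xi -> R) (h : 'cV[R]_d -> R) :
  compact X ->
  measurable_fun ((X : set (borelcV R d)) `*` setT)
    (fun p : borelcV R d * Xi => g p.1 p.2) ->
  {within X, continuous h} ->
  (forall a, X a -> {ae mu, forall s, g a s = h a}) ->
  {ae P, forall w, X (averaged gamma y0 x k w) ->
     g (averaged gamma y0 x k w) (xi k w) = h (averaged gamma y0 x k w)}.
Proof.
move=> cX mg ch gh; have [mxi lawxi mx ind] := draws.
apply: (@independent_pair_ae_eq _ _ _ _ _ _ _ P mu
  (averaged gamma y0 x k : Omega -> borelcV R d) _ _ _ _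
  (X : set (borelcV R d))) => //.
- exact: (@measurable_averaged _ _ _ _ _ _ _ k).
- move=> A B mA mB; rewrite ind ?lawxi//.
  pose H := [set A | exists2 i, (i < k)%N &
     preimage_set_system setT (xi i) measurable A \/
     preimage_set_system setT (x i.+1) measurable A].
  (* The same choices on [Omega] equipped with the history as sigma-algebra: measurability of
     [averaged] there says that its preimages are events of the history. *)
  pose x' : nat -> g_sigma_algebraType H -> borelcV R d := x.
  have mx' j : (j < k)%N -> measurable_fun setT (x' j.+1).
    move=> jk _ C mC; apply: sub_sigma_algebra; exists j => //; right.
    by exists C.
  have := @measurable_averaged _ _ _ _ gamma y0 x' k mx' k (leqnn k)
    measurableT A mA.
  by rewrite setTI.
- by apply: closed_measurable_borelcV; exact: compact_closed.
- exact: within_continuous_measurable_borelcV.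
Qed.

End exactness_at_random_iterates.

(** * Single trajectories with unit tracker weights *)

Section exact_trajectories.
Context {R : realType} {d n : nat} {Xi : Type}.
Variables (X : set 'cV[R]_d) (F : 'cV[R]_n -> 'cV[R]_d -> R).
Variables (f : 'cV[R]_d -> 'cV[R]_n) (J : 'cV[R]_d -> 'M[R]_(n, d)).
Variables (ft : 'cV[R]_d -> Xi -> 'cV[R]_n).
Variables (Jt : 'cV[R]_d -> Xi -> 'M[R]_(n, d)).
Variables (t : tracker) (gamma beta rho : nat -> R) (y0 : 'cV[R]_d).
Variables (xi : nat -> Xi) (x y : nat -> 'cV[R]_d).
Variables (z : nat -> 'cV[R]_n) (V : nat -> 'M[R]_(n, d)).
Hypothesis X_convex : convex_set X.
Hypothesis gamma01 : in01 gamma.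
Hypothesis X_y0 : X y0.
Hypothesis run : hybrid_run X F ft Jt t gamma beta rho y0 xi x y z V.
Hypothesis beta1 : forall k, beta k = 1.
Hypothesis rho1 : forall k, rho k = 1.

Lemma hybrid_run_feasible k : X (y k).
Proof.
elim: k => [|k IH]; first by rewrite (run_y0 run).
rewrite (run_y run); have [Xx _] := run_x run k.
have /andP[g0 g1] := gamma01 k.
by apply: convex_set_average => //; rewrite g1 ltW.
Qed.

(** Unit weights erase the past, including the Taylor correction, so both variants coincide; index 0
    is the initialization. *)
Lemma hybrid_run_trackers k : z k = ft (y k) (xi k) /\ V k = Jt (y k) (xi k).
Proof.
case: k => [|k]; first by rewrite (run_z0 run) (run_V0 run) (run_y0 run).
rewrite (run_z run) (run_V run) rho1 beta1 subrr !scale0r !scale1r !add0r.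
by case: t.
Qed.

Lemma hybrid_run_basic_method :
  (forall k, z k = f (y k) /\ V k = J (y k)) ->
  basic_method X F f J gamma y0 x y.
Proof.
move=> exact; split=> [|k]; first exact: run_y0 run.
split; last exact: run_y run k.
by have [zE VE] := exact k; have := run_x run k; rewrite zE VE.
Qed.

End exact_trajectories.

Unset Implicit Arguments.

Theorem corollary1
  (R : realType) (d n : nat)
  (dXi dO : measure_display)
  (Xi : measurableType dXi) (mu : probability Xi R)
  (Omega : measurableType dO) (P : probability Omega R)
  (X : set 'cV[R]_d) (F : 'cV[R]_n -> 'cV[R]_d -> R)
  (f : 'cV[R]_d -> 'cV[R]_n) (J : 'cV[R]_d -> 'M[R]_(n, d))
  (ft : 'cV[R]_d -> Xi -> 'cV[R]_n) (Jt : 'cV[R]_d -> Xi -> 'M[R]_(n, d))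
  (LF L : R) (t : tracker) (gamma beta rho : nat -> R) (y0 : 'cV[R]_d)
  (xi : nat -> Omega -> Xi) (x y : nat -> Omega -> 'cV[R]_d)
  (z : nat -> Omega -> 'cV[R]_n) (V : nat -> Omega -> 'M[R]_(n, d))
  (* the problem *)
  (X_convex : convex_set X)
  (X_compact : compact X)
  (F_lipschitz : lipschitz_outer X F LF)
  (F_monotone : monotone_outer X F)
  (F_subhomogeneous : subhomogeneous_outer X F)
  (f_jacobian : has_jacobian X f J)
  (J_lipschitz : forall a b, X a -> X b ->
     opnorm (J a - J b) <= L * enorm (a - b))
  (gaps_attained : attained_gaps X F f J)
  (* the oracle *)
  (oracle : stochastic_oracle mu X f ft Jt)
  (oracle_exact : exact_oracle mu X f J ft Jt)
  (* the algorithm *)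
  (gamma01 : in01 gamma) (beta01 : in01 beta) (rho01 : in01 rho)
  (X_y0 : X y0)
  (draws : independent_draws mu P xi x)
  (run : {ae P, forall w, hybrid_run X F ft Jt t gamma beta rho y0
     (xi ^~ w) (x ^~ w) (y ^~ w) (z ^~ w) (V ^~ w)})
  (beta1 : forall k, beta k = 1) (rho1 : forall k, rho k = 1) :
  [/\ {ae P, forall w, forall k, (1 <= k)%N ->
         V k w = J (y k w) /\ z k w = f (y k w)},
      {ae P, forall w, basic_method X F f J gamma y0 (x ^~ w) (y ^~ w)},
      convex_components X f -> jointly_convex_outer X F ->
      (forall k, gamma k = 2 / (k%:R + 2)) ->
      forall xs, is_argmin X (objective F f) xs ->
      {ae P, forall w, forall K, (1 <= K)%N ->
         objective F f (y K w) - objective F f xs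
           <= 2 * curvature X F f J / (K%:R + 1)} &
      (* joint convexity of F is needed here as well *)
      jointly_convex_outer X F ->
      (forall k, gamma k = 1 / Num.sqrt (k%:R + 1)) ->
      forall xs, is_argmin X (objective F f) xs ->
      let Phi0 := objective F f y0 - objective F f xs in
      {ae P, forall w, forall K, (1 <= K)%N ->
         \big[Num.min/fw_gap X F f J (y 0%N w)]_(k < K.+1)
             fw_gap X F f J (y k w)
           <= (Phi0 + 1 / 2 * curvature X F f J * (1 + ln (K%:R + 1)))
                / Num.sqrt (K%:R + 1)}].
Proof.
have exact_k : {ae P, forall w k, X (y k w) ->
    ft (y k w) (xi k w) = f (y k w) /\ Jt (y k w) (xi k w) = J (y k w)}.
  have [mft mJt _ _ _] := oracle.
  pose Y := averaged gamma y0 x.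
  have ft_k k i : {ae P, forall w, X (Y k w) ->
      ft (Y k w) (xi k w) i 0 = f (Y k w) i 0}.
    apply: (exact_at_iterates (g := fun a s => ft a s i 0)
      (h := fun a => f a i 0) draws gamma y0 k X_compact (mft i)).
      exact: has_jacobian_continuous f_jacobian i.
    by move=> a Xa; apply: filterS (oracle_exact a Xa) => s [-> _].
  have Jt_k k i j : {ae P, forall w, X (Y k w) ->
      Jt (Y k w) (xi k w) i j = J (Y k w) i j}.
    apply: (exact_at_iterates (g := fun a s => Jt a s i j)
      (h := fun a => J a i j) draws gamma y0 k X_compact (mJt i j)).
      exact: lipschitz_jacobian_continuous J_lipschitz i j.
    by move=> a Xa; apply: filterS (oracle_exact a Xa) => s [_ ->].
  (* Countably many iterates and finitely many entries leave a single exceptional null set. *)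
  have ft_all : {ae P, forall w k i, X (Y k w) ->
      ft (Y k w) (xi k w) i 0 = f (Y k w) i 0}.
    by apply/ae_foralln => k; apply: filter_forall => i; exact: ft_k.
  have Jt_all : {ae P, forall w k i j, X (Y k w) ->
      Jt (Y k w) (xi k w) i j = J (Y k w) i j}.
    apply/ae_foralln => k; apply: filter_forall => i.
    by apply: filter_forall => j; exact: Jt_k.
  apply: filterS3 run ft_all Jt_all => w run_w ft_w Jt_w k.
  have -> : y k w = Y k w.
    elim: k => [|k IH]; first exact: run_y0 run_w.
    by rewrite (run_y run_w) /= IH.
  move=> XY; split; first by apply/colP => i; exact: ft_w.
  by apply/matrixP => i j; exact: Jt_w.
(* Feasibility along a run, which holds whatever the trackers are, discharges the condition
   [X (y k w)]. *)
have exact_run : {ae P, forall w k, z k w = f (y k w) /\ V k w = J (y k w)}.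
  apply: filterS2 run exact_k => w run_w exact_w k.
  have [-> ->] := hybrid_run_trackers run_w beta1 rho1 k.
  by apply: exact_w; exact: hybrid_run_feasible run_w k.
have basic : {ae P, forall w,
    basic_method X F f J gamma y0 (x ^~ w) (y ^~ w)}.
  apply: filterS2 run exact_run => w run_w exact_w.
  exact: hybrid_run_basic_method run_w exact_w.
split=> //.
- by apply: filterS exact_run => w exact_w k _; have [] := exact_w k.
- move=> cf cF gE xs xsP; apply: filterS basic => w basic_w.
  exact: (basic_method_convex_rate X_convex X_compact F_lipschitz F_monotone
    f_jacobian J_lipschitz gamma01 X_y0 basic_w).
- move=> cF gE xs xsP Phi0; apply: filterS basic => w basic_w K _.
  exact: (basic_method_nonconvex_rate X_convex X_compact F_lipschitz
    f_jacobian J_lipschitz gamma01 X_y0 basic_w).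
Qed.
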